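(* Let $X\subset\mathbb{R}^d$ be a complementary regular set, let $f:\mathbb{R}^d\to\mathbb{R}$ be $C^2$, and let $a<b$ be reals such that every $t\in[a,b]$ is a regular value of $f_{|X}$. Then $X_a=X\cap f^{-1}(-\infty,a]$ is a deformation retract of $X_b=X\cap f^{-1}(-\infty,b]$.
   Context: Notation: $d_A(x)=\inf_{a\in A}\|x-a\|$; Clarke gradient $\partial\phi(x)$ of a locally Lipschitz $\phi$: convex hull of limits $\lim_i\nabla\phi(x_i)$, $x_i\to x$, $\phi$ differentiable at $x_i$; $\Delta(B)=\inf_{b\in B}\|b\|$. Complement set $\mathcal{C}A:=\overline{\mathbb{R}^d\setminus A}$; $\partial A=\overline A\setminus\operatorname{int}A$. Reach of closed $A$: supremum of $t\ge0$ such that every $x$ with $d_A(x)<t$ has a unique nearest point in $A$. For $\mu\in(0,1]$, $\operatorname{reach}_\mu(A)=\sup\{s:\Delta(\partial d_A(x))\ge\mu\text{ for all }x\text{ with }0<d_A(x)\le s\}$. A compact $X$ is complementary regular if $\overline{\operatorname{int}X}=X$, $\operatorname{reach}_\mu(X)>0$ for some $\mu\in(0,1]$ and $\operatorname{reach}(\mathcal{C}X)>0$. Tangent cone $\operatorname{Tan}(A,x)$: cone generated by limits of $(x_n-x)/\|x_n-x\|$, $x_n\in A\setminus\{x\}$, $x_n\to x$; polar cone $B^\circ=\{u:\langle u,b\rangle\le 0\ \forall b\in B\}$; for closed $A$ of positive reach $\operatorname{Nor}(A,x)=\operatorname{Tan}(A,x)^\circ$. For complementary regular $X$, $\operatorname{Nor}(X,x):=-\operatorname{Nor}(\mathcal{C}X,x)$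 for $x\in\partial X$ and $\{0\}$ for $x\in\operatorname{int}X$. A point $x\in X$ is a critical point of $f_{|X}$ if $\nabla f(x)\in-\operatorname{Nor}(X,x)$; $t$ is a regular value of $f_{|X}$ if $f^{-1}(t)\cap X$ contains no critical point. *)

(* Defs.v *)
From HB Require Import structures.
From mathcomp Require Import all_boot all_order all_algebra.
From mathcomp Require Import all_classical all_reals all_analysis.
Set Implicit Arguments. Unset Strict Implicit. Unset Printing Implicit Defensive.
Import Order.TTheory GRing.Theory Num.Theory numFieldNormedType.Exports.
Local Open Scope classical_set_scope.
Local Open Scope ring_scope.

Section Defs.
Context {R : realType} {d : nat}.
Local Notation V := 'rV[R]_d.

Definition dotv (u v : V) : R := \sum_(i < d) u 0 i * v 0 i.
Definition enorm (u : V) : R := Num.sqrt (dotv u u).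

Definition dist_set (A : set V) (x : V) : R := inf [set enorm (x - a) | a in A].

(* gradient of phi at x (meaningful where phi is differentiable) *)
Definition gradient (phi : V -> R) (x : V) : V :=
  \row_(i < d) ('d phi x (delta_mx 0 i)).

Definition grad_limits (phi : V -> R) (x : V) : set V :=
  [set g | exists xs : nat -> V, (forall n, differentiable phi (xs n)) /\
     xs @ \oo --> x /\ (fun n => gradient phi (xs n)) @ \oo --> g].

Definition conv_hull (B : set V) : set V :=
  [set y | exists (n : nat) (lam : 'I_n -> R) (p : 'I_n -> V),
     (forall i, 0 <= lam i) /\ \sum_(i < n) lam i = 1 /\
     (forall i, B (p i)) /\ y = \sum_(i < n) lam i *: p i].

Definition clarke_grad (phi : V -> R) (x : V) : set V := conv_hull (grad_limits phi x).

Definition Delta (B : set V) : R := inf [set enorm b | b in B].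

Definition unique_nearest (A : set V) (x : V) : Prop :=
  exists! a, A a /\ enorm (x - a) = dist_set A x.

Definition reach (A : set V) : \bar R :=
  ereal_sup [set t%:E | t in [set t : R | 0 <= t /\
     forall x, dist_set A x < t -> unique_nearest A x]].

Definition reach_mu (mu : R) (A : set V) : \bar R :=
  ereal_sup [set s%:E | s in [set s : R |
     forall x, 0 < dist_set A x <= s -> mu <= Delta (clarke_grad (dist_set A) x)]].

Definition compl_set (A : set V) : set V := closure (~` A).
Definition boundary (A : set V) : set V := closure A `\` A^°.

Definition comp_regular (X : set V) : Prop :=
  compact X /\ closure (X^°) = X /\
  (exists mu : R, 0 < mu <= 1 /\ (0 < reach_mu mu X)%E) /\
  (0 < reach (compl_set X))%E.

Definition lim_dirs (A : set V) (x : V) : set V :=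
  [set u | exists xs : nat -> V, (forall n, A (xs n) /\ xs n <> x) /\
     xs @ \oo --> x /\
     (fun n => (enorm (xs n - x))^-1 *: (xs n - x)) @ \oo --> u].

Definition tan_cone (A : set V) (x : V) : set V :=
  [set v | v = 0 \/ exists (lam : R) (u : V), 0 <= lam /\ lim_dirs A x u /\ v = lam *: u].

Definition polar (B : set V) : set V := [set u | forall b, B b -> dotv u b <= 0].

Definition nor (A : set V) (x : V) : set V := polar (tan_cone A x).

Definition nor_cr (X : set V) (x : V) : set V :=
  [set u | (boundary X x /\ [set - w | w in nor (compl_set X) x] u) \/
           (X^° x /\ u = 0)].

Definition critical_point (f : V -> R) (X : set V) (x : V) : Prop :=
  X x /\ [set - w | w in nor_cr X x] (gradient f x).

Definition regular_value (f : V -> R) (X : set V) (t : R) : Prop :=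
  forall x, X x -> f x = t -> ~ critical_point f X x.

Definition C2 (f : V -> R) : Prop :=
  (forall x, differentiable f x) /\ (forall x, differentiable (gradient f) x) /\
  (forall v : V, continuous (fun x => 'd (gradient f) x v)).

Definition sublevel (X : set V) (f : V -> R) (a : R) : set V := [set x | X x /\ f x <= a].

Definition deformation_retract (A B : set V) : Prop :=
  A `<=` B /\ exists H : R -> V -> V,
    {within [set p : R * V | 0 <= p.1 <= 1 /\ B p.2], continuous (fun p => H p.1 p.2)} /\
    (forall t x, 0 <= t <= 1 -> B x -> B (H t x)) /\
    (forall x, B x -> H 0 x = x) /\
    (forall x, B x -> A (H 1 x)) /\
    (forall t x, 0 <= t <= 1 -> A x -> H t x = x).

End Defs.

(* Main.v *)
Require Import Defs.
From HB Require Import structures.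
From mathcomp Require Import all_boot all_order all_algebra.
From mathcomp Require Import all_classical all_reals all_analysis.
From mathcomp Require Import ring lra.
Import Order.TTheory GRing.Theory Num.Theory numFieldNormedType.Exports.
Local Open Scope classical_set_scope.
Local Open Scope ring_scope.

(** Write C for the closure of the complement of X.
    - A maximizer of d_A - mu |. - z| on a ball around z shows, without any flow,
      that a point outside A can be moved by at most r so as to reach distance
      mu r from A, as soon as d_A has slope larger than mu near A. For A = C
      (unique nearest points, slope 1) this yields, at every boundary point of
      X, a ball of fixed radius contained in X; for A = X (the Clarke gradient
      of d_X is bounded away from 0) it yields, near every boundary point x0, a
      point q whose distance to X is comparable to |q - x0|.
    - If x0 is not critical, some c in C close to x0 satisfies
      <grad f(x0), c - x0> > 0. The vector v = (x0 - c) + eta |c - x0| (x0 - q)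
      still decreases f, and makes an acute angle with the radii of all the
      balls above near x0: moving along v from points of X near x0 stays in X.
    - Such local moves, cut off by bump functions, are composed finitely many
      times and iterated until f has dropped below a on X_b; stopping each
      trajectory at level a gives the deformation retraction. *)

(** * Continuity of pairs, minima, maxima and composites *)

Lemma continuous_pair {T U V : topologicalType} (f : T -> U) (g : T -> V) :
  continuous f -> continuous g -> continuous (fun x => (f x, g x)).
Proof. by move=> cf cg x; apply: cvg_pair; [exact: cf|exact: cg]. Qed.

Lemma continuous_minr {R : realType} {T : topologicalType} (f g : T -> R) :
  continuous f -> continuous g -> continuous (fun x => Num.min (f x) (g x)).
Proof. by move=> cf cg x; apply: continuous_min; [exact: cf|exact: cg]. Qed.

Lemma continuous_maxr {R : realType} {T : topologicalType} (f g : T -> R) :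
  continuous f -> continuous g -> continuous (fun x => Num.max (f x) (g x)).
Proof. by move=> cf cg x; apply: continuous_max; [exact: cf|exact: cg]. Qed.

Lemma continuous_compose {T U V : topologicalType} (f : T -> U) (g : U -> V) :
  continuous f -> continuous g -> continuous (fun x => g (f x)).
Proof. by move=> cf cg x; apply: continuous_comp; [exact: cf|exact: cg]. Qed.

(** * The Euclidean norm on row vectors *)

Section EuclideanSpace.
Context {R : realType} {d : nat}.
Implicit Types u v w x y z : 'rV[R]_d.

Lemma dotvC u v : dotv u v = dotv v u.
Proof. by apply: eq_bigr => i _; rewrite mulrC. Qed.

Lemma dotvDl u v w : dotv (u + v) w = dotv u w + dotv v w.
Proof. by rewrite /dotv -big_split; apply: eq_bigr => i _; rewrite mxE mulrDl. Qed.

Lemma dotvZl k u v : dotv (k *: u) v = k * dotv u v.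
Proof. by rewrite /dotv mulr_sumr; apply: eq_bigr => i _; rewrite mxE mulrA. Qed.

Lemma dotvNl u v : dotv (- u) v = - dotv u v.
Proof. by rewrite -scaleN1r dotvZl mulN1r. Qed.

Lemma dot0v v : dotv 0 v = 0.
Proof. by rewrite -(scale0r 0) dotvZl mul0r. Qed.

Lemma dotvDr u v w : dotv u (v + w) = dotv u v + dotv u w.
Proof. by rewrite dotvC dotvDl !(dotvC u). Qed.

Lemma dotvZr k u v : dotv u (k *: v) = k * dotv u v.
Proof. by rewrite dotvC dotvZl dotvC. Qed.

Lemma dotvNr u v : dotv u (- v) = - dotv u v.
Proof. by rewrite dotvC dotvNl dotvC. Qed.

Definition dotvE := (dotvDl, dotvDr, dotvNl, dotvNr, dotvZl, dotvZr).

Lemma dotvv_ge0 u : 0 <= dotv u u.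
Proof. by apply: sumr_ge0 => i _; rewrite -expr2 sqr_ge0. Qed.

Lemma enorm_ge0 u : 0 <= enorm u. Proof. exact: sqrtr_ge0. Qed.

Lemma enorm_sqr u : enorm u ^+ 2 = dotv u u.
Proof. by rewrite sqr_sqrtr // dotvv_ge0. Qed.

Lemma enormZ k u : enorm (k *: u) = `|k| * enorm u.
Proof. by rewrite /enorm !dotvE mulrA -expr2 sqrtrM ?sqr_ge0// sqrtr_sqr. Qed.

Lemma enormN u : enorm (- u) = enorm u.
Proof. by rewrite /enorm !dotvE opprK. Qed.

Lemma enorm0 : enorm (0 : 'rV[R]_d) = 0.
Proof. by rewrite -(scale0r 0) enormZ normr0 mul0r. Qed.

Lemma enormBC u v : enorm (u - v) = enorm (v - u).
Proof. by rewrite -enormN opprB. Qed.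

Lemma enorm_eq0 u : enorm u = 0 -> u = 0.
Proof.
move=> u0; have : dotv u u = 0 by rewrite -enorm_sqr u0 expr0n.
move=> /eqP; rewrite psumr_eq0; last by move=> i _; rewrite -expr2 sqr_ge0.
move=> /allP uu0; apply/rowP => i; rewrite mxE; apply/eqP.
by have := uu0 i (mem_index_enum i); rewrite mulf_eq0 orbb.
Qed.

Lemma enorm_gt0 u : u <> 0 -> 0 < enorm u.
Proof. by move=> u0; rewrite lt_def enorm_ge0 andbT; apply/eqP => /enorm_eq0. Qed.

Lemma sqr_enormB u v : enorm (u - v) ^+ 2 = enorm u ^+ 2 - 2 * dotv u v + enorm v ^+ 2.
Proof. by rewrite !enorm_sqr !dotvE (dotvC v u); ring. Qed.

Lemma sqr_enormD u v : enorm (u + v) ^+ 2 = enorm u ^+ 2 + 2 * dotv u v + enorm v ^+ 2.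
Proof. by rewrite !enorm_sqr !dotvE (dotvC v u); ring. Qed.

(** Cauchy-Schwarz, by expanding the square of [enorm v *: u - enorm u *: v]. *)
Lemma dotv_le u v : dotv u v <= enorm u * enorm v.
Proof.
have [u0|/eqP u0] := eqVneq (enorm u) 0.
  by rewrite u0 mul0r (enorm_eq0 _ u0) dot0v.
have [v0|/eqP v0] := eqVneq (enorm v) 0.
  by rewrite v0 mulr0 (enorm_eq0 _ v0) dotvC dot0v.
have nu : 0 < enorm u by rewrite lt_def enorm_ge0 andbT; apply/eqP.
have nv : 0 < enorm v by rewrite lt_def enorm_ge0 andbT; apply/eqP.
have := sqr_ge0 (enorm (enorm v *: u - enorm u *: v)).
rewrite sqr_enormB !enormZ !gtr0_norm// !dotvE => h.
have {h} : 0 <= 2 * (enorm u * enorm v) * (enorm u * enorm v - dotv u v).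
  by apply: le_trans h _; rewrite le_eqVlt; apply/orP; left; apply/eqP; ring.
by rewrite pmulr_rge0 ?subr_ge0// !mulr_gt0.
Qed.

Lemma ler_enormD u v : enorm (u + v) <= enorm u + enorm v.
Proof.
rewrite -(@ler_pXn2r _ 2) ?nnegrE ?addr_ge0 ?enorm_ge0//.
by rewrite sqr_enormD; have := dotv_le u v; nra.
Qed.

Lemma ler_enorm_dist z x y : enorm (x - y) <= enorm (x - z) + enorm (z - y).
Proof. by rewrite -[x - y](subrKA z); exact: ler_enormD. Qed.

(** Row vectors carry the topology of the max norm; this bound and the converse [enorm_le_mxnorm]
    transfer it to Euclidean balls. The factor [d.+1] there stays positive for d = 0. *)
Lemma mxnorm_le_enorm u : `|u| <= enorm u.
Proof.
rewrite [leLHS]/Num.norm /= mx_normrE; apply/bigmax_leP; split=> [|[i j] _ /=].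
  exact: enorm_ge0.
rewrite (ord1 i) -(@ler_pXn2r _ 2) ?nnegrE ?normr_ge0 ?enorm_ge0//.
rewrite enorm_sqr real_normK ?num_real// /dotv (bigD1 j)//= -expr2 lerDl.
by apply: sumr_ge0 => k _; rewrite -expr2 sqr_ge0.
Qed.

Lemma enorm_le_mxnorm u : enorm u <= d.+1%:R * `|u|.
Proof.
rewrite -(@ler_pXn2r _ 2) ?nnegrE ?mulr_ge0 ?enorm_ge0// enorm_sqr.
have : dotv u u <= d%:R * `|u| ^+ 2.
  rewrite -[d in d%:R]card_ord -sum1_card natr_sum mulr_suml.
  apply: ler_sum => i _; rewrite mul1r -expr2 -(real_normK (num_real (u 0 i))).
  rewrite ler_pXn2r ?nnegrE ?normr_ge0//.
  by rewrite [leRHS]/Num.norm /= mx_normrE; apply/bigmax_geP; right => /=; exists (0, i).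
move=> /le_trans; apply; rewrite exprMn ler_wpM2r ?sqr_ge0//.
by rewrite -natrX ler_nat -mulnn mulSn; exact: leq_trans (leqnSn d) (leq_addr _ _).
Qed.

Lemma nbhs_enormP x (P : set 'rV[R]_d) :
  nbhs x P <-> exists2 e, 0 < e & forall y, enorm (y - x) < e -> P y.
Proof.
split=> [/(@nbhs_normP R 'rV[R]_d)[e /= e0 eP]|[e e0 eP]].
  exists e => // y yx; apply: eP => /=.
  by rewrite distrC; exact: le_lt_trans (mxnorm_le_enorm _) yx.
apply/(@nbhs_normP R 'rV[R]_d); exists (e / d.+1%:R) => /=; first by rewrite divr_gt0.
move=> y /=; rewrite distrC ltr_pdivlMr// mulrC => yx; apply: eP.
exact: le_lt_trans (enorm_le_mxnorm _) yx.
Qed.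

Lemma lip_continuous (g : 'rV[R]_d -> R) (k : R) :
  (forall x y, g x - g y <= k * enorm (x - y)) -> continuous g.
Proof.
move=> glip x; apply: (iffRL (@cvgrPdist_lt _ _ _ _ (nbhs_filter x) g (g x))) => e e0.
apply: (iffRL (nbhs_enormP _ _)); exists (e / (`|k| + 1)).
  by rewrite divr_gt0// ltr_wpDl.
move=> y /=.
rewrite ltr_pdivlMr; last by rewrite ltr_wpDl.
move=> yx; have h1 := glip x y; have h2 := glip y x.
rewrite enormBC in h1; have := enorm_ge0 (y - x); have := ler_norm k.
by rewrite ltr_norml; nra.
Qed.

Lemma dotv_continuous v : continuous (dotv^~ v).
Proof.
apply: (@lip_continuous _ (enorm v)) => x y.
by rewrite -dotvNl -dotvDl mulrC dotv_le.
Qed.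

Lemma enormB_continuous x : continuous (fun y => enorm (y - x)).
Proof.
apply: (@lip_continuous _ 1) => y z; rewrite mul1r lerBlDr.
exact: ler_enorm_dist.
Qed.

Lemma compact_closed_ball x r : compact [set y | enorm (y - x) <= r].
Proof.
apply: bounded_closed_compact.
  exists (r + `|x|); split; first exact: num_real.
  move=> M rM y /= yx; apply/ltW; apply: le_lt_trans rM.
  rewrite -[y](subrK x); apply: (le_trans (ler_normD _ _)).
  by rewrite lerD2r; exact: le_trans (mxnorm_le_enorm _) yx.
have -> : [set y | enorm (y - x) <= r] = (fun y => enorm (y - x)) @^-1` [set t | t <= r] by [].
by apply: closed_comp (@closed_le _ r) => y _; exact: enormB_continuous.
Qed.

Lemma compact_max (g : 'rV[R]_d -> R) (A : set 'rV[R]_d) : A !=set0 -> compact A ->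
  continuous g -> exists2 x, A x & forall y, A y -> g y <= g x.
Proof.
move=> A0 cA /continuous_subspaceT cg.
have [x /set_mem Ax xmax] := compact_EVT_max A0 cA (cg A).
by exists x => // y Ay; apply: xmax; exact: mem_set.
Qed.

Lemma compact_min (g : 'rV[R]_d -> R) (A : set 'rV[R]_d) : A !=set0 -> compact A ->
  continuous g -> exists2 x, A x & forall y, A y -> g x <= g y.
Proof.
move=> A0 cA /continuous_subspaceT cg.
have [x /set_mem Ax xmin] := compact_EVT_min A0 cA (cg A).
by exists x => // y Ay; apply: xmin; exact: mem_set.
Qed.

End EuclideanSpace.

(** * The distance function and its ascent directions *)

Section DistanceFunction.
Context {R : realType} {d : nat}.
Implicit Types (A : set 'rV[R]_d) (u v w x y z p : 'rV[R]_d).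

Let has_lbound_dist A x : has_lbound [set enorm (x - a) | a in A].
Proof. by exists 0 => _ [a _ <-]; exact: enorm_ge0. Qed.

Lemma dist_set_le A a x : A a -> dist_set A x <= enorm (x - a).
Proof. by move=> Aa; apply: ge_inf => //; exists a. Qed.

Lemma dist_set_ge A r x : A !=set0 -> (forall a, A a -> r <= enorm (x - a)) ->
  r <= dist_set A x.
Proof.
move=> [a Aa] Ar; apply: lb_le_inf; first by exists (enorm (x - a)), a.
by move=> _ [b Ab <-]; exact: Ar.
Qed.

Lemma dist_set_lip A x y : A !=set0 -> dist_set A x - dist_set A y <= enorm (x - y).
Proof.
move=> A0; rewrite lerBlDr -lerBlDl; apply: dist_set_ge => // a Aa.
by rewrite lerBlDl; apply: le_trans (dist_set_le _ _ _ Aa) _; exact: ler_enorm_dist.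
Qed.

Lemma dist_set_continuous A : A !=set0 -> continuous (dist_set A).
Proof. by move=> A0; apply: (@lip_continuous _ _ _ 1) => x y; rewrite mul1r dist_set_lip. Qed.

Lemma nearest_exists A x : closed A -> A !=set0 ->
  exists2 p, A p & enorm (x - p) = dist_set A x.
Proof.
move=> clA [a Aa]; pose K := A `&` [set y | enorm (y - x) <= enorm (a - x)].
have cK : compact K.
  by rewrite /K setIC; apply: compact_closedI => //; exact: compact_closed_ball.
have [|p [Ap _] pmin] := compact_min _ _ _ cK (@enormB_continuous _ _ x).
  by exists a; split => /=.
exists p => //; apply/eqP; rewrite eq_le dist_set_le// andbT.
apply: dist_set_ge; first by exists a.
move=> b Ab; rewrite (enormBC x p) (enormBC x b).
have [ba|/ltW ab] := leP (enorm (b - x)) (enorm (a - x)); first exact: pmin.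
by apply: le_trans ab; apply: pmin; split=> //=.
Qed.

Lemma dist_set_gt0 A x : closed A -> A !=set0 -> ~ A x -> 0 < dist_set A x.
Proof.
move=> clA A0 nAx; have [p Ap <-] := nearest_exists A x clA A0.
by apply: enorm_gt0 => /eqP; rewrite subr_eq0 => /eqP xp; apply: nAx; rewrite xp.
Qed.

(* Directional derivative of the distance at y in the direction w: it is the
   minimum over the nearest points p of <y - p, w> / |y - p|. *)
Lemma dist_set_ascent A y w (kappa mu e : R) : closed A -> A !=set0 ->
  0 < dist_set A y -> enorm w <= 1 -> 0 <= mu < kappa -> 0 < e ->
  (forall p, A p -> enorm (y - p) = dist_set A y ->
     kappa * dist_set A y <= dotv (y - p) w) ->
  exists y', enorm (y' - y) < e /\ dist_set A y + mu * enorm (y' - y) < dist_set A y'.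
Proof.
move=> clA A0 d0 w1 /andP[mu0 muk] e0 nearw.
set D := dist_set A y in d0 nearw *.
pose k := (kappa + mu) / 2.
have muk' : mu < k by rewrite /k; lra.
have kk : k < kappa by rewrite /k; lra.
(* By compactness the strict bound, with k in place of kappa, extends from the nearest points to the
   almost nearest ones. *)
have [eta eta0 Heta] : exists2 eta, 0 < eta &
    forall p, A p -> enorm (y - p) < D + eta -> k * D < dotv (y - p) w.
  pose P := A `&` ([set p | enorm (p - y) <= D + 1] `&` [set p | dotv (y - p) w <= k * D]).
  have cP : compact P.
    rewrite /P setIC; apply: compact_closedI => //; apply: compact_closedI.
      exact: compact_closed_ball.
    have -> : [set p | dotv (y - p) w <= k * D] =
        (dotv^~ w) @^-1` [set t | dotv y w - k * D <= t].
      apply/seteqP; split=> p /=; rewrite !dotvE; lra.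
    by apply: closed_comp (@closed_ge _ _) => q _; exact: dotv_continuous.
  have [P0|/set0P nP] := eqVneq P set0.
    exists 1 => // p Ap yp; rewrite ltNge; apply/negP => bad.
    have : P p by split=> //; split=> //=; rewrite enormBC ltW.
    by rewrite P0.
  have [q [Aq [_ /= qbad]] qmin] := compact_min _ _ nP cP (@enormB_continuous _ _ y).
  have Dq : D < enorm (q - y).
    rewrite lt_def enormBC dist_set_le// andbT; apply/eqP => qD.
    have := nearw q Aq qD; have : k * D < kappa * D by rewrite ltr_pM2r.
    lra.
  exists (Num.min 1 (enorm (q - y) - D)) => [|p Ap yp].
    by rewrite lt_min ltr01 subr_gt0.
  move: yp; rewrite -ltrBlDl lt_min => /andP[yp1 yp2].
  rewrite ltNge; apply/negP => bad.
  have : P p by split=> //; split=> //=; rewrite enormBC; lra.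
  by move=> /qmin; rewrite (enormBC p y); lra.
(* The three bounds keep the new point within e of y, make points of A at distance at least D + eta
   from y harmless, and make the second-order term mu^2 t^2 smaller than the gain 2 t (k - mu) D. *)
pose t := Num.min (e / 2) (Num.min (eta / (2 * (mu + 1))) ((k - mu) * D / (mu ^+ 2 + 1))).
have mu2 : 0 < mu ^+ 2 + 1 by rewrite ltr_wpDl ?sqr_ge0.
have t0 : 0 < t.
  rewrite !lt_min divr_gt0//= divr_gt0//=; last by lra.
  by rewrite divr_gt0// mulr_gt0// subr_gt0.
have [te teta tk] : [/\ t <= e / 2, t * (2 * (mu + 1)) <= eta &
    t * (mu ^+ 2 + 1) <= (k - mu) * D].
  split; first by rewrite ge_min lexx.
    by rewrite -ler_pdivlMr ?ge_min ?lexx ?orbT//; lra.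
  by rewrite -ler_pdivlMr// !ge_min lexx !orbT.
exists (y + t *: w); rewrite addrAC subrr add0r enormZ gtr0_norm//.
have tw : t * enorm w <= t by rewrite -[leRHS]mulr1 ler_pM2l.
split; first lra.
suff : D + mu * t < dist_set A (y + t *: w).
  by apply: le_lt_trans; rewrite lerD2l ler_wpM2l.
have [p Ap <-] := nearest_exists A (y + t *: w) clA A0.
have yp : enorm (y - p) <= enorm (y + t *: w - p) + t.
  apply: (le_trans (ler_enorm_dist (y + t *: w) _ _)); rewrite addrC lerD2l.
  by rewrite opprD addNKr enormN enormZ gtr0_norm.
have Dp : D <= enorm (y - p) by exact: dist_set_le.
have [close|far] := ltP (enorm (y - p)) (D + eta); last by nra.
have yw := Heta p Ap close.
rewrite -(@ltr_pXn2r _ 2) ?nnegrE ?enorm_ge0//; last by nra.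
rewrite addrAC sqr_enormD enormZ gtr0_norm// dotvZr.
have : D ^+ 2 <= enorm (y - p) ^+ 2 by rewrite ler_pXn2r ?nnegrE ?enorm_ge0// ltW.
have := sqr_ge0 (t * enorm w).
nra.
Qed.

(* Ekeland-type argument: the constrained maximizer of dist_A - mu |. - z|
   replaces the flow of the generalized gradient of the distance. *)
Lemma escape A z (mu s r : R) : closed A -> A !=set0 -> 0 <= mu -> 0 <= r ->
  mu * r <= s ->
  (forall y e, 0 < dist_set A y <= s -> 0 < e -> exists y',
     enorm (y' - y) < e /\ dist_set A y + mu * enorm (y' - y) < dist_set A y') ->
  ~ A z ->
  exists2 y, enorm (y - z) <= r & mu * r <= dist_set A y.
Proof.
move=> clA A0 mu0 r0 rs asc nAz; have dz := dist_set_gt0 A z clA A0 nAz.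
pose g y := dist_set A y - mu * enorm (y - z).
have cg : continuous g.
  apply: (@lip_continuous _ _ _ (1 + mu)) => x y.
  have := dist_set_lip A x y A0; have := ler_enorm_dist x y z.
  by rewrite /g (enormBC y x); nra.
have B0 : [set y | enorm (y - z) <= r] !=set0 by exists z; rewrite /= subrr enorm0.
have [y /= yr ymax] := compact_max _ _ B0 (compact_closed_ball z r) cg.
have gy : dist_set A z <= g y.
  by apply: le_trans (ymax z _); rewrite /g /= subrr enorm0 ?mulr0 ?subr0.
have gey := enorm_ge0 (y - z).
exists y => //; rewrite leNgt; apply/negP => bad.
(* On the sphere g would be negative, against [gy]; so the maximizer is interior and leaves room for
   an ascent step, which would increase g. *)
have ltr_ : enorm (y - z) < r.
  rewrite lt_neqAle yr andbT; apply/eqP => e; move: gy; rewrite /g e; lra.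
have dy : 0 < dist_set A y <= s.
  apply/andP; split; last by lra.
  by move: gy; rewrite /g; nra.
have [|y' [y'e y'd]] := asc y (r - enorm (y - z)) dy; first by rewrite subr_gt0.
have h := ler_enorm_dist y y' z.
have : g y' <= g y by apply: ymax => /=; lra.
by rewrite /g; nra.
Qed.

End DistanceFunction.

(** * The Clarke gradient of the distance function *)

Section ClarkeGradient.
Context {R : realType} {d : nat}.
Implicit Types (A B : set 'rV[R]_d) (u v w x y z p g G : 'rV[R]_d).

Lemma dotv_linear G : linear (dotv G : 'rV[R]_d -> R^o).
Proof. by move=> k u v; rewrite !dotvE. Qed.

(** A quadratic remainder is a little o, and the differential is unique. *)
Lemma quadratic_differentiable (phi : 'rV[R]_d -> R) x G (K : R) :
  (forall h, `|phi (x + h) - phi x - dotv G h| <= K * enorm h ^+ 2) ->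
  differentiable phi x /\ gradient phi x = G.
Proof.
move=> quad.
pose dGM := GRing.isLinear.Build _ _ _ _ _ (dotv_linear G).
pose dG : {linear 'rV[R]_d -> R} := HB.pack (dotv G : 'rV[R]_d -> R) dGM.
have cG : continuous dG.
  rewrite (_ : (dG : _ -> _) = dotv^~ G); first exact: dotv_continuous.
  by apply/funext => u; rewrite dotvC.
have expand : phi \o shift x = cst (phi x) + dG +o_ (0 : 'rV[R]_d) id.
  apply/eqaddoP => e e0; apply: (iffRL (nbhs_enormP _ _)).
  pose M : R := (`|K| + 1) * d.+1%:R.
  have M0 : 0 < M by rewrite mulr_gt0// ltr_wpDl.
  exists (e / M) => [|h]; first by rewrite divr_gt0.
  rewrite subr0 ltr_pdivlMr// => he.
  have -> : (phi \o shift x - (cst (phi x) + dG)) h = phi (x + h) - phi x - dotv G h.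
    by rewrite !fctE /= opprD addrA (addrC h).
  apply: (le_trans (quad h)).
  have h1 := enorm_le_mxnorm h; have h0 := enorm_ge0 h.
  have Kh : K * enorm h ^+ 2 <= (`|K| + 1) * enorm h * enorm h.
    by rewrite expr2 mulrA !ler_wpM2r// (le_trans (ler_norm K))// lerDl.
  apply: (le_trans Kh).
  apply: (@le_trans _ _ ((`|K| + 1) * enorm h * (d.+1%:R * `|h|))).
    by rewrite ler_wpM2l// mulr_ge0// ltW// ltr_wpDl.
  by rewrite mulrA ler_wpM2r// mulrAC mulrC ltW// /M mulrC.
have dE : 'd phi x = dG :> (_ -> _) by apply: diff_unique cG expand.
split; first by apply/diff_locallyP; rewrite dE.
apply/rowP => i; rewrite mxE dE /dG /= /dotv (bigD1 i)//= mxE !eqxx mulr1.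
by rewrite big1 ?addr0// => j ji; rewrite mxE eqxx (negbTE ji) mulr0.
Qed.

(** With X the norm on the left, X <= (X^2 + m^2) / (2 m), and X^2 is expanded using |G| = 1. *)
Lemma enorm_unit_perturb (m : R) G h : 0 < m -> enorm G = 1 ->
  enorm (m *: G + h) <= m + dotv G h + enorm h ^+ 2 / (2 * m).
Proof.
move=> m0 G1; set X := enorm _.
have XE : X ^+ 2 = m ^+ 2 + 2 * m * dotv G h + enorm h ^+ 2.
  by rewrite sqr_enormD enormZ G1 mulr1 dotvZl real_normK ?num_real// mulrA.
have -> : m + dotv G h + enorm h ^+ 2 / (2 * m) = (X ^+ 2 + m ^+ 2) / (2 * m).
  by rewrite XE; field; rewrite lt0r_neq0.
rewrite ler_pdivlMr ?mulr_gt0//.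
by have := sqr_ge0 (X - m); rewrite sqrrB; lra.
Qed.

(* Between y and a nearest point p, the distance is squeezed between the smooth
   functions |. - p| and |y - p| - |y - .|, which share value and gradient. *)
Lemma dist_set_gradient A y p (t : R) : A p -> enorm (y - p) = dist_set A y ->
  0 < dist_set A y -> 0 < t < 1 ->
  differentiable (dist_set A) (p + t *: (y - p)) /\
  gradient (dist_set A) (p + t *: (y - p)) = (dist_set A y)^-1 *: (y - p).
Proof.
move=> Ap yp; set D := dist_set A y => D0 /andP[t0 t1].
set G := D^-1 *: (y - p).
have G1 : enorm G = 1 by rewrite enormZ yp gtr0_norm ?invr_gt0// mulVf// lt0r_neq0.
have ypE : y - p = D *: G by rewrite scalerA divff ?lt0r_neq0// scale1r.
have m0 : 0 < t * D by rewrite mulr_gt0.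
have k0 : 0 < (1 - t) * D by rewrite mulr_gt0// subr_gt0.
have A0 : A !=set0 by exists p.
rewrite ypE scalerA.
have dx h : dist_set A (p + (t * D) *: G + h) <= t * D + dotv G h + enorm h ^+ 2 / (2 * (t * D)).
  apply: le_trans (dist_set_le _ _ _ Ap) _.
  by rewrite -(addrA p) addrAC subrr add0r; exact: enorm_unit_perturb.
have dx' h : t * D + dotv G h - enorm h ^+ 2 / (2 * ((1 - t) * D)) <=
    dist_set A (p + (t * D) *: G + h).
  have := dist_set_lip A y (p + (t * D) *: G + h) A0; rewrite -/D.
  have -> : y - (p + (t * D) *: G + h) = ((1 - t) * D) *: G + (- h).
    rewrite mulrBl mul1r scalerBl -ypE.
    by apply/rowP => i; rewrite !mxE; ring.
  have := enorm_unit_perturb ((1 - t) * D) G (- h) k0 G1.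
  by rewrite enormN dotvNr; lra.
have dxE : dist_set A (p + (t * D) *: G) = t * D.
  have := dx 0; have := dx' 0; rewrite enorm0 expr0n !mul0r dotvC dot0v !addr0 subr0.
  lra.
apply: (@quadratic_differentiable _ _ _ ((2 * (t * D))^-1 + (2 * ((1 - t) * D))^-1)) => h.
have := dx h; have := dx' h.
have a0 : 0 <= enorm h ^+ 2 / (2 * (t * D)) by rewrite divr_ge0 ?sqr_ge0// mulr_ge0// ltW.
have b0 : 0 <= enorm h ^+ 2 / (2 * ((1 - t) * D)).
  by rewrite divr_ge0 ?sqr_ge0// mulr_ge0// ltW.
rewrite dxE ler_norml [(_ + _) * enorm h ^+ 2]mulrC mulrDr; lra.
Qed.

(** The gradient of the distance is constant on the open segment from p to y, whose points are made
    to tend to y. The offset n + 2 keeps [t n] strictly between 0 and 1. *)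
Lemma nearest_grad_limit A y p : A p -> enorm (y - p) = dist_set A y ->
  0 < dist_set A y -> grad_limits (dist_set A) y ((dist_set A y)^-1 *: (y - p)).
Proof.
move=> Ap yp D0; pose t n : R := 1 - (n.+2%:R)^-1.
have t01 n : 0 < t n < 1.
  by rewrite /t subr_gt0 gtrBl invr_gt0 invf_lt1// ltr1n ltr0n.
exists (fun n => p + t n *: (y - p)); split=> [n|]; first by have [] := dist_set_gradient A y p (t n).
split; last first.
  rewrite (_ : (fun n => _) = fun=> (dist_set A y)^-1 *: (y - p)); first exact: cvg_cst.
  by apply/funext => n; have [] := dist_set_gradient A y p (t n).
rewrite -[in X in _ --> X](subrK p y) [X in _ --> X]addrC.
apply: cvgD; first exact: cvg_cst.
rewrite -[X in _ --> X]scale1r; apply: cvgZr_tmp.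
rewrite -[X in _ --> X]subr0; apply: cvgB; first exact: cvg_cst.
by have := @cvg_harmonic R; rewrite -cvg_shiftS.
Qed.

Lemma conv_hull_segment B g G (s : R) : conv_hull B g -> B G -> 0 <= s <= 1 ->
  conv_hull B ((1 - s) *: g + s *: G).
Proof.
move=> [n [lam [q [lam0 [lam1 [Bq ->]]]]]] BG /andP[s0 s1].
exists n.+1, (fun i => if unlift ord0 i is Some j then (1 - s) * lam j else s),
  (fun i => if unlift ord0 i is Some j then q j else G).
split=> [i|]; first by case: unlift => // j; rewrite mulr_ge0// subr_ge0.
rewrite !big_ord_recl !unlift_none; split; [|split].
- rewrite (eq_bigr (fun j => (1 - s) * lam j)) => [|j _]; last by rewrite liftK.
  by rewrite -mulr_sumr lam1 mulr1 subrKC.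
- by move=> i; case: unlift.
rewrite addrC scaler_sumr; congr (_ + _).
by apply: eq_bigr => j _; rewrite liftK scalerA.
Qed.

(* Almost minimal elements of the Clarke gradient are ascent directions for the
   distance; working with them avoids closing the convex hull. *)
Lemma clarke_direction A y (mu mu' : R) : closed A -> A !=set0 -> 0 < dist_set A y ->
  0 < mu' < mu -> mu <= Delta (clarke_grad (dist_set A) y) ->
  exists2 w, enorm w <= 1 & forall p, A p -> enorm (y - p) = dist_set A y ->
     mu' * dist_set A y <= dotv (y - p) w.
Proof.
move=> clA A0; set D := dist_set A y => D0 /andP[mu'0 mu'mu].
set B := grad_limits (dist_set A) y; rewrite /clarke_grad -/B.
have BG p : A p -> enorm (y - p) = D -> B (D^-1 *: (y - p)).
  by move=> Ap yp; exact: nearest_grad_limit.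
have G1 p : enorm (y - p) = D -> enorm (D^-1 *: (y - p)) = 1.
  by move=> yp; rewrite enormZ yp gtr0_norm ?invr_gt0// mulVf// lt0r_neq0.
have conv1 G : B G -> conv_hull B G.
  move=> BG'; exists 1%N, (fun=> 1), (fun=> G); split=> //; split.
    by rewrite big_ord1.
  by split=> //; rewrite big_ord1 scale1r.
set E := Delta _ => muE.
have Elb g : conv_hull B g -> E <= enorm g.
  move=> Bg; apply: ge_inf; last by exists g.
  by exists 0 => _ [? _ <-]; exact: enorm_ge0.
have [p Ap yp] := nearest_exists A y clA A0.
have E1 : E <= 1 by rewrite -(G1 p yp); apply: Elb; apply: conv1; exact: BG.
(* The 6 pays for 5 s lost in [dotv G g >= |g|^2 - 5 s], which comes from almost minimality of g,
   and for s lost in |g| <= E + s. *)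
pose s := E * (E - mu') / 6.
have s0 : 0 < s by rewrite divr_gt0// mulr_gt0; lra.
have s1 : s <= 1 by rewrite /s; nra.
have infB : has_inf [set enorm b | b in conv_hull B].
  split; last by exists 0 => _ [? _ <-]; exact: enorm_ge0.
  by exists 1, (D^-1 *: (y - p)); [apply: conv1; exact: BG|exact: G1].
have s23 : 0 < s ^+ 2 / 3 by rewrite divr_gt0// exprn_gt0.
have [_ [g Bg <-] gE] := inf_adherent s23 infB.
rewrite -[inf _]/E in gE.
have Eg := Elb _ Bg.
have g0 : 0 < enorm g by lra.
exists ((enorm g)^-1 *: g) => [|q Aq yq].
  by rewrite enormZ gtr0_norm ?invr_gt0// mulVf// lt0r_neq0.
set G := D^-1 *: (y - q).
have -> : y - q = D *: G by rewrite scalerA divff ?lt0r_neq0// scale1r.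
rewrite dotvZl dotvZr [leLHS]mulrC ler_pM2l//.
rewrite mulrC ler_pdivlMr//.
(* First variation: moving from g towards G inside the hull cannot bring the norm below E. *)
have : E <= enorm ((1 - s) *: g + s *: G).
  apply: Elb; apply: conv_hull_segment => //; first exact: BG.
  by rewrite (ltW s0).
rewrite -(@ler_pXn2r _ 2) ?nnegrE ?enorm_ge0//; last by lra.
have -> : (1 - s) *: g + s *: G = g + s *: (G - g).
  by rewrite scalerBl scale1r scalerBr addrAC addrA.
rewrite sqr_enormD dotvZr dotvDr dotvNr -enorm_sqr enormZ (gtr0_norm s0) exprMn (dotvC g G).
have GG : enorm (G - g) <= 3.
  by apply: (le_trans (ler_enormD _ _)); rewrite enormN (G1 q yq); nra.
have GG2 : enorm (G - g) ^+ 2 <= 9.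
  have -> : 9 = 3 ^+ 2 :> R by rewrite -natrX.
  by rewrite ler_pXn2r ?nnegrE ?enorm_ge0.
have gE2 : enorm g ^+ 2 <= E ^+ 2 + s ^+ 2.
  have : enorm g <= E + s ^+ 2 / 3 by exact: ltW.
  have : s ^+ 2 <= 1 by rewrite expr_le1// ltW.
  have : 0 <= s ^+ 2 by exact: sqr_ge0.
  nra.
have gs : enorm g <= E + s.
  by apply: ltW; apply: lt_le_trans gE _; rewrite lerD2l; nra.
have s6 : s * 6 = E * (E - mu') by rewrite /s; field.
move=> H.
have H1 : 0 <= s * (2 * (dotv G g - enorm g ^+ 2) + s + s * 9) by nra.
rewrite pmulr_rge0// in H1.
have : E ^+ 2 <= enorm g ^+ 2 by rewrite ler_pXn2r ?nnegrE ?enorm_ge0//; lra.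
nra.
Qed.

End ClarkeGradient.

(** * Geometry at the boundary *)

Section BoundaryGeometry.
Context {R : realType} {d : nat}.
Implicit Types (B C X : set 'rV[R]_d) (v x y z p q : 'rV[R]_d).

Lemma closure_enormP B x :
  closure B x <-> forall e, 0 < e -> exists2 z, B z & enorm (z - x) < e.
Proof.
split=> [Bx e e0|Bx U /nbhs_enormP[e e0 eU]].
  have [|z [Bz ze]] := Bx [set z | enorm (z - x) < e]; last by exists z.
  by apply: (iffRL (nbhs_enormP _ _)); exists e.
by have [z Bz ze] := Bx e e0; exists z; split=> //; exact: eU.
Qed.

(** [escape] starts outside X, hence from a point within r of x, which explains the radius 2 r. The
    slopes mu, mu / 2, mu / 4 leave the strict margins that [clarke_direction] and [dist_set_ascent]
    require. *)
Lemma reach_mu_escape X (mu : R) : closed X -> X !=set0 -> 0 < mu <= 1 ->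
  (0 < reach_mu mu X)%E ->
  exists m s : R, [/\ 0 < m <= 1, 0 < s & forall x r, closure (~` X) x -> 0 < r <= s ->
    exists2 q, enorm (q - x) <= 2 * r & m * r <= dist_set X q].
Proof.
move=> clX X0 /andP[mu0 mu1] /ereal_sup_gt[_ [s sX <-]]; rewrite lte_fin => s0.
exists (mu / 4), s; split=> [||x r clx /andP[r0 rs]] //; first by lra.
have /closure_enormP/(_ r r0)[z nXz zx] := clx.
have [|||y e /andP[dy ys] e0||q qz dq] := @escape _ _ X z (mu / 4) s r clX X0 => //.
- by lra.
- by lra.
- by nra.
- have [||w w1 nw] := clarke_direction X y mu (mu / 2) clX X0 dy; first by lra.
    by apply: sX; rewrite dy.
  by apply: dist_set_ascent w1 _ e0 nw => //; lra.
exists q => //; have := ler_enorm_dist z q x; lra.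
Qed.

(* Where nearest points are unique the distance has slope 1, so [escape] applies with
   every slope 1 - e'; the exact statement follows by compactness. *)
Lemma reach_exterior_ball C : closed C -> (0 < reach C)%E ->
  exists2 r, 0 < r & forall x, C x -> closure (~` C) x ->
    exists2 y, enorm (y - x) = r & r <= dist_set C y.
Proof.
move=> clC /ereal_sup_gt[_ [t [_ tC] <-]]; rewrite lte_fin => t0.
exists (t / 2) => [|x Cx clx]; first by lra.
have C0 : C !=set0 by exists x.
set r := t / 2; have r0 : 0 < r by rewrite /r; lra.
have B0 : [set y | enorm (y - x) <= r] !=set0 by exists x; rewrite /= subrr enorm0 ltW.
have [y /= yr ymax] := compact_max _ _ B0 (compact_closed_ball x r) (dist_set_continuous C C0).
suff ry : r <= dist_set C y.
  exists y => //; apply/eqP; rewrite eq_le yr; apply: le_trans ry _.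
  exact: dist_set_le.
apply/ler_addgt0Pr => e e0.
(* Slope 1 - e' loses e' r, and translating q from the ball around z to the ball around x loses at
   most e'; together at most e. *)
pose e' := Num.min (1 / 2) (e / (r + 1)).
have e'0 : 0 < e' by rewrite lt_min divr_gt0//= divr_gt0//; lra.
have e'1 : e' <= 1 / 2 by rewrite ge_min lexx.
have e'e : e' * (r + 1) <= e by rewrite -ler_pdivlMr ?ge_min ?lexx ?orbT//; lra.
have /closure_enormP/(_ e' e'0)[z nCz zx] := clx.
have [|||p f /andP[dp ps] f0||q qz dq] := @escape _ _ C z (1 - e') r r clC C0 => //.
- by lra.
- by lra.
- by nra.
- have [|a [[Ca pa] ua]] := tC p; first by rewrite /r in ps; lra.
  apply: (@dist_set_ascent _ _ _ _ ((dist_set C p)^-1 *: (p - a)) 1) => //.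
  + by rewrite enormZ pa gtr0_norm ?invr_gt0// mulVf// lt0r_neq0.
  + by lra.
  + move=> b Cb pb; rewrite -(ua b)// dotvZr -enorm_sqr pa expr2 mulrA mulVf ?lt0r_neq0//.
have : dist_set C (q - (z - x)) <= dist_set C y.
  by apply: ymax => /=; rewrite opprB addrA addrAC addrK.
have := dist_set_lip C q (q - (z - x)) C0; rewrite subKr.
lra.
Qed.

(* Consider the last time at which the segment is in X. *)
Lemma inward_segment X v x0 (rho : R) : closed X ->
  (forall x, X x -> closure (~` X) x -> enorm (x - x0) < rho -> exists y (r : R),
     [/\ forall z, enorm (z - y) < r -> X z, enorm (y - x) = r & 0 < dotv v (y - x)]) ->
  forall x (s : R), X x -> enorm (x - x0) < rho / 2 -> 0 <= s -> s * enorm v < rho / 2 ->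
  X (x + s *: v).
Proof.
move=> clX ball x s Xx xx0 s0 sv; apply: contrapT => nXs.
pose S := `[0, s]%classic `&` [set u : R | X (x + u *: v)].
have cS : compact S.
  apply: compact_closedI; first exact: segment_compact.
  apply: (@closed_comp _ _ (fun u : R => x + u *: v) X) => // u _.
  by apply: cvgD; [exact: cvg_cst|apply: cvgZr_tmp; exact: cvg_id].
have S0 : S !=set0 by exists 0; split; rewrite /= ?in_itv/= ?lexx ?s0// scale0r addr0.
have cid : {within S, continuous (id : R -> R)}.
  by apply: continuous_subspaceT => y; exact: cvg_id.
have [u /set_mem[/=]] := compact_EVT_max S0 cS cid.
rewrite in_itv/= => /andP[u0 us] Xu umax.
have {}us : u < s by rewrite lt_neqAle us andbT; apply/eqP => us'; rewrite us' in Xu.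
have nX k : 0 < k <= s - u -> ~ X (x + u *: v + k *: v).
  move=> /andP[k0 ks]; rewrite -addrA -scalerDl => Xk.
  have : u + k <= u by apply: umax; apply/mem_set; split=> //=; rewrite in_itv/=; lra.
  lra.
have ev := enorm_ge0 v.
have xu0 : enorm (x + u *: v - x0) < rho.
  rewrite addrAC; apply: (le_lt_trans (ler_enormD _ _)).
  by rewrite enormZ ger0_norm//; nra.
have clu : closure (~` X) (x + u *: v).
  apply/closure_enormP => e e0; pose k := Num.min (s - u) (e / (enorm v + 1)).
  have k0 : 0 < k by rewrite lt_min subr_gt0 us divr_gt0//; lra.
  have ke : k * (enorm v + 1) <= e.
    by rewrite -ler_pdivlMr ?ge_min ?lexx ?orbT//; lra.
  exists (x + u *: v + k *: v); first by apply: nX; rewrite k0/= ge_min lexx.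
  by rewrite addrAC subrr add0r enormZ gtr0_norm//; nra.
have [y [r [yX yr vy]]] := ball _ Xu clu xu0.
set b := dotv v _ in vy; set x' := x + u *: v in yX yr b vy nX.
(* The radius at x' makes an acute angle with v, so for this k the term k^2 |v|^2 is below 2 k b and
   the step k v enters the open ball, past the last time u. *)
pose k := Num.min (s - u) (b / (enorm v ^+ 2 + 1)).
have v2 : 0 < enorm v ^+ 2 + 1 by rewrite ltr_wpDl ?sqr_ge0.
have k0 : 0 < k by rewrite lt_min subr_gt0 us divr_gt0.
have kb : k * (enorm v ^+ 2 + 1) <= b.
  by rewrite -ler_pdivlMr// ge_min lexx orbT.
apply: (nX k); first by rewrite k0/= ge_min lexx.
apply: yX; rewrite -yr -(@ltr_pXn2r _ 2) ?nnegrE ?enorm_ge0//.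
have -> : x' + k *: v - y = k *: v - (y - x') by rewrite opprB [RHS]addrCA [RHS]addrA.
rewrite sqr_enormB dotvZl -/b enormZ exprMn (gtr0_norm k0); nra.
Qed.

End BoundaryGeometry.

(** * Directions that decrease f and point into X *)

Section LocalDirection.
Context {R : realType} {d : nat}.
Implicit Types (A X : set 'rV[R]_d) (u v x y p q g : 'rV[R]_d).

Lemma diff_gradient (f : 'rV[R]_d -> R) x v :
  'd f x v = dotv (gradient f x) v.
Proof.
rewrite [v in LHS]row_sum_delta linear_sum; apply: eq_bigr => i _.
by rewrite linearZ mxE mulrC.
Qed.

(** The pairing of the gradient with v stays negative on a ball, and the mean value theorem applies
    on segments in it. Half of its radius is left for x - x0 and half for t v. *)
Lemma descent_direction (f : 'rV[R]_d -> R) x0 v :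
  (forall x, differentiable f x) -> continuous (gradient f) ->
  dotv (gradient f x0) v < 0 ->
  exists2 rho : R, 0 < rho & forall x (s t : R), enorm (x - x0) < rho ->
    0 <= s -> s < t -> t * enorm v < rho -> f (x + t *: v) < f (x + s *: v).
Proof.
move=> df cg gv.
have cgv : continuous (fun z => dotv (gradient f z) v).
  move=> z; apply: (@continuous_comp _ _ _ (gradient f) (dotv^~ v)); first exact: cg.
  exact: dotv_continuous.
have : nbhs x0 [set z | dotv (gradient f z) v < 0] by exact: (cvgr_lt _ (cgv x0) _ gv).
move=> /nbhs_enormP[e e0 eP]; exists (e / 2) => [|x s t xx0 s0 st tv].
  by rewrite divr_gt0.
have dline (k : R) : is_diff k (fun k : R => x + k *: v) (fun h => h *: v).
  by apply: is_diff_eq; apply/funext => h; rewrite !fctE /= add0r.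
have dln (k : R) : differentiable (fun k : R => x + k *: v) k by case: (dline k).
have dfl (k : R) : differentiable (f \o (fun k : R => x + k *: v)) k.
  by apply: differentiable_comp; [exact: dln|exact: df].
have dg (k : R) : k \in `]s, t[ ->
    is_derive k 1 (f \o (fun k => x + k *: v)) (dotv (gradient f (x + k *: v)) v).
  move=> _; apply: DeriveDef; first exact/derivable1_diffP.
  rewrite deriveE// diff_comp//.
  have -> : 'd (fun k : R => x + k *: v) k = (fun h => h *: v) :> (_ -> _).
    by case: (dline k).
  by rewrite /= scale1r diff_gradient.
have cgl : {within `[s, t], continuous (f \o (fun k => x + k *: v))}.
  by apply: continuous_subspaceT => k; exact: differentiable_continuous.
have [k kst E] := MVT st dg cgl.
have /andP[sk kt] : s < k < t by move: kst; rewrite in_itv.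
have ts0 : 0 < t - s by rewrite subr_gt0.
rewrite -subr_lt0; suff gk : dotv (gradient f (x + k *: v)) v < 0.
  by have := gk; rewrite -(pmulr_llt0 _ ts0) -E.
clear - eP xx0 s0 sk kt tv.
apply: eP; rewrite addrAC; apply: (le_lt_trans (ler_enormD _ _)).
rewrite enormZ ger0_norm; last by lra.
have := enorm_ge0 v; nra.
Qed.

(** Otherwise the point dividing the segment from y to q in the ratio r : s would lie in X and
    closer than s to q. *)
Lemma disjoint_balls X y q (r s : R) : 0 < r -> 0 < s ->
  (forall z, enorm (z - y) < r -> X z) -> s <= dist_set X q -> r + s <= enorm (q - y).
Proof.
move=> r0 s0 yX sq; rewrite leNgt; apply/negP => L.
have rs : 0 < r + s by lra.
set l := enorm _ in L.
pose z := y + (r / (r + s)) *: (q - y).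
have : X z.
  apply: yX; rewrite /z addrAC subrr add0r enormZ gtr0_norm ?divr_gt0//.
  by rewrite mulrAC ltr_pdivrMr// ltr_pM2l.
move=> /(dist_set_le _ _ q); apply/negP; rewrite -ltNge; apply: lt_le_trans sq.
have -> : q - z = (s / (r + s)) *: (q - y).
  have -> : s / (r + s) = 1 - r / (r + s) by field; rewrite lt0r_neq0.
  by rewrite scalerBl scale1r /z opprD addrA.
by rewrite enormZ gtr0_norm ?divr_gt0// mulrAC ltr_pdivrMr// ltr_pM2l.
Qed.

(** Expansion of |y - p|^2 around x: a point p far from the centre y lies, up to a quadratic error,
    on the outer side of the radius at x. *)
Lemma outside_ball_dotv x y p (k : R) : 0 <= k -> k <= enorm (y - p) ->
  k ^+ 2 - enorm (y - x) ^+ 2 - enorm (x - p) ^+ 2 <= 2 * dotv (x - p) (y - x).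
Proof.
move=> k0; rewrite -(@ler_pXn2r _ 2) ?nnegrE ?enorm_ge0//.
have -> : y - p = (y - x) + (x - p) by rewrite subrKA.
by rewrite (sqr_enormD (y - x)) (dotvC (y - x)); lra.
Qed.

(** Trades a tangent direction for a point of A: normalized differences tend to u, so they
    eventually keep half of its pairing with g. *)
Lemma lim_dirs_approx A x u g (e : R) : lim_dirs A x u -> 0 < dotv g u -> 0 < e ->
  exists c, [/\ A c, 0 < enorm (c - x), enorm (c - x) < e &
    dotv g u / 2 * enorm (c - x) <= dotv g (c - x)].
Proof.
move=> [xs [xsA [xsx xsu]]] gu e0.
have Ux : nbhs x [set z | enorm (z - x) < e] by apply: (iffRL (nbhs_enormP _ _)); exists e.
have near1 : \forall n \near \oo, enorm (xs n - x) < e := xsx _ Ux.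
have near2 : \forall n \near \oo,
    dotv g u / 2 < dotv ((enorm (xs n - x))^-1 *: (xs n - x)) g.
  have cvu := continuous_cvg _ (dotv_continuous g u) xsu.
  have gu2 : dotv g u / 2 < dotv u g by rewrite (dotvC u); lra.
  exact: (cvgr_gt _ (cvu _) _ gu2).
have [n [n1 n2]] := filter_ex (filterI near1 near2).
have [Axn xnx] := xsA n.
have p0 : 0 < enorm (xs n - x).
  by apply: enorm_gt0 => /eqP; rewrite subr_eq0 => /eqP.
exists (xs n); split=> //.
by move: n2; rewrite dotvZl [ltRHS]mulrC ltr_pdivlMr// (dotvC (xs n - x)) => /ltW.
Qed.

(* v = (x0 - c) + eta |c - x0| (x0 - q): the first term descends along g and is
   almost orthogonal to the exterior normals at x0, since c is almost tangent; the
   second one, coming from reach_mu, makes a definite acute angle with them. *)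
Lemma boundary_direction X x0 u g (m s r : R) :
  closed X -> 0 < m <= 1 -> 0 < s -> 0 < r ->
  (forall x t, closure (~` X) x -> 0 < t <= s ->
    exists2 q, enorm (q - x) <= 2 * t & m * t <= dist_set X q) ->
  (forall x, X x -> closure (~` X) x ->
    exists2 y, enorm (y - x) = r & r <= dist_set (closure (~` X)) y) ->
  closure (~` X) x0 ->
  lim_dirs (closure (~` X)) x0 u -> 0 < dotv g u ->
  exists v (rho : R), [/\ 0 < rho, dotv g v < 0 &
    forall x, X x -> closure (~` X) x -> enorm (x - x0) < rho -> exists y (r' : R),
     [/\ forall z, enorm (z - y) < r' -> X z, enorm (y - x) = r' & 0 < dotv v (y - x)]].
Proof.
move=> clX /andP[m0 m1] s0 r0 esc ball bx0 ux0 gu.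
(* This makes the quadratic error 8 t^2 caused by q at most a quarter of r sigma. *)
pose t := Num.min s (r * m / 32).
have t0 : 0 < t by rewrite lt_min s0/= divr_gt0// mulr_gt0.
have ts : t <= s by rewrite ge_min lexx.
have tr : t <= r * m / 32 by rewrite ge_min lexx orbT.
have [|q qx0 mq] := esc x0 t bx0; first by rewrite t0.
pose sigma := m * t.
have sg0 : 0 < sigma by rewrite mulr_gt0.
have g0 := enorm_ge0 g.
have G0 : 0 < enorm g * (2 * t) + 1 by rewrite ltr_wpDl// mulr_ge0//; lra.
(* With this eta the second term of v spends at most half of the descent del [dotv g u] / 2 ensured
   by the first. *)
pose eta := dotv g u / 4 / (enorm g * (2 * t) + 1).
have eta0 : 0 < eta by rewrite !divr_gt0.
have etaG : eta * (enorm g * (2 * t) + 1) = dotv g u / 4.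
  by rewrite divfK ?lt0r_neq0.
have [|c [Cc c0 ce gc]] := lim_dirs_approx _ _ _ g (eta * r * sigma / 8) ux0 gu.
  by rewrite divr_gt0// (mulr_gt0 (mulr_gt0 eta0 r0) sg0).
set del := enorm _ in c0 ce gc.
have ed0 : 0 < eta * del by rewrite mulr_gt0.
(* The first two bounds give |x - q| <= 4 t and |x - c| <= 2 del; the others absorb
   [dotv (x - x0) e]. *)
pose rho := Num.min (Num.min (2 * t) del) (Num.min (sigma / 4) (eta * del * sigma / 8)).
have eds : 0 < eta * del * sigma by rewrite (mulr_gt0 ed0 sg0).
have rho0 : 0 < rho by rewrite !lt_min c0 !divr_gt0// mulr_gt0.
have [rt rd rs re] : [/\ rho <= 2 * t, rho <= del, rho <= sigma / 4 &
    rho <= eta * del * sigma / 8].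
  by split; rewrite !ge_min lexx ?orbT.
exists ((x0 - c) + (eta * del) *: (x0 - q)), rho; split=> //.
  rewrite dotvDr dotvZr -[x0 - c]opprB dotvNr.
  have gq : dotv g (x0 - q) <= enorm g * (2 * t).
    by apply: le_trans (dotv_le _ _) _; rewrite ler_wpM2l// enormBC.
  have h1 : eta * del * dotv g (x0 - q) <= eta * del * (enorm g * (2 * t)).
    by rewrite ler_pM2l.
  have h2 : eta * del * (enorm g * (2 * t)) <= del * (dotv g u / 4).
    by rewrite -etaG; nra.
  have : 0 < del * (dotv g u / 4) by rewrite mulr_gt0// divr_gt0.
  lra.
move=> x Xx bx xx0; have [y yx yC] := ball x Xx bx.
have yX z : enorm (z - y) < r -> X z.
  move=> zy; apply: contrapT => nXz.
  have : closure (~` X) z by exact: subset_closure.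
  by move=> /(dist_set_le _ _ y); rewrite enormBC; lra.
exists y, r; split=> //.
set e := y - x.
(* The gap sigma between q and X makes [dotv (x - q) e] at least r sigma, up to a quadratic
   error. *)
have qy := disjoint_balls X y q r sigma r0 sg0 yX mq.
rewrite enormBC in qy.
have hc := outside_ball_dotv x y c r (ltW r0) (le_trans yC (dist_set_le _ _ y Cc)).
have hq := outside_ball_dotv x y q (r + sigma) (ltW (addr_gt0 r0 sg0)) qy.
rewrite -/e yx in hc hq.
have hx : dotv (x - x0) e <= rho * r.
  apply: (le_trans (dotv_le _ _)); rewrite yx ler_wpM2r//; exact: ltW.
have P2 : - (2 * del ^+ 2) <= dotv (x - c) e.
  have := ler_enorm_dist x0 x c; rewrite (enormBC x0 c) -/del.
  have := enorm_ge0 (x - c); nra.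
have Q2 : r * sigma - 8 * t ^+ 2 <= dotv (x - q) e.
  have := ler_enorm_dist x0 x q; rewrite (enormBC x0 q).
  have := enorm_ge0 (x - q); nra.
have t8 : 8 * t ^+ 2 <= r * sigma / 4 by rewrite /sigma; nra.
have rr : rho * r <= r * sigma / 4 by nra.
have Q3 : r * sigma / 2 <= dotv (x - q) e - dotv (x - x0) e by lra.
have Q4 : eta * del * (r * sigma / 2) <= eta * del * (dotv (x - q) e - dotv (x - x0) e).
  by rewrite ler_pM2l.
have re' : rho * r <= eta * del * sigma / 8 * r by rewrite ler_pM2r.
have ce' : del * del < del * (eta * r * sigma / 8) by rewrite ltr_pM2l.
(* In units of eta del r sigma, the last term gains at least 1/2, while c costs less than 1/4 and x
   - x0 at most 1/8. *)
have -> : dotv (x0 - c + (eta * del) *: (x0 - q)) e =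
    dotv (x - c) e - dotv (x - x0) e + eta * del * (dotv (x - q) e - dotv (x - x0) e).
  by rewrite !dotvE; ring.
have pos : 0 < eta * del * (r * sigma) by rewrite (mulr_gt0 ed0 (mulr_gt0 r0 sg0)).
rewrite expr2 in P2; lra.
Qed.

End LocalDirection.

(** * Descending homotopies *)

Section Homotopy.
Context {R : realType} {d : nat}.
Implicit Types (X : set 'rV[R]_d) (x : 'rV[R]_d).
Implicit Types (f : 'rV[R]_d -> R) (F G : R -> 'rV[R]_d -> 'rV[R]_d).

Lemma C2_continuous_gradient f : C2 f -> continuous (gradient f).
Proof. by move=> [_ [df _]] x; exact: differentiable_continuous. Qed.

Lemma comp_regular_direction X f x0 : comp_regular X -> C2 f -> X x0 ->
  ~ critical_point f X x0 ->
  exists v, dotv (gradient f x0) v < 0 /\ exists2 rho : R, 0 < rho &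
    forall x s, X x -> enorm (x - x0) < rho -> 0 <= s -> s * enorm v < rho ->
      X (x + s *: v).
Proof.
move=> [cX [rX [[mu [mu01 reachX]] reachC]]] [df _] Xx0 ncrit.
have clX : closed X by apply: compact_closed => //; exact: norm_hausdorff.
have [intx0|bx0] := pselect (X° x0).
  exists (- gradient f x0); split.
    rewrite dotvNr -enorm_sqr oppr_lt0 exprn_gt0//; apply: enorm_gt0 => g0.
    by apply: ncrit; split=> //; exists 0; [right|rewrite oppr0 g0].
  have /nbhs_enormP[e e0 eX] : nbhs x0 X by [].
  exists (e / 2) => [|x s Xx xx0 s0 sv]; first by rewrite divr_gt0.
  apply: eX; rewrite addrAC; apply: (le_lt_trans (ler_enormD _ _)).
  by rewrite enormZ ger0_norm//; lra.
have bdx0 : boundary X x0 by split=> //; exact: subset_closure.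
have {}bx0 : closure (~` X) x0 by rewrite closure_setC.
(* The minus signs in [nor_cr] and [critical_point] cancel: the gradient is not in the polar of the
   tangent cone of the complement set. *)
have [u ux0 gu] : exists2 u, lim_dirs (compl_set X) x0 u & 0 < dotv (gradient f x0) u.
  apply: contrapT => nu; apply: ncrit; split=> //; exists (- gradient f x0); last exact: opprK.
  left; split=> //; exists (gradient f x0) => // b [->|[lam [u [lam0 [ux0 ->]]]]].
    by rewrite dotvC dot0v.
  rewrite dotvZr mulr_ge0_le0// leNgt; apply/negP => gu; apply: nu.
  by exists u.
have [m [s [m01 s0 esc]]] := reach_mu_escape X mu clX (ex_intro _ _ Xx0) mu01 reachX.
have [r r0 ball] := reach_exterior_ball _ (@closed_closure _ (~` X)) reachC.
have bdball x : X x -> closure (~` X) x ->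
    exists2 y, enorm (y - x) = r & r <= dist_set (closure (~` X)) y.
  by move=> Xx bx; apply: ball => //; rewrite (closure_setC X) setCK rX.
have [v [rho [rho0 gv vball]]] := boundary_direction X x0 u _ m s r clX m01 s0 r0 esc bdball bx0 ux0 gu.
exists v; split=> //; exists (rho / 2) => [|x t Xx xx0 t0 tv]; first by rewrite divr_gt0.
exact: (inward_segment X v x0 rho clX vball).
Qed.

(** Turns the bounds on the length [s * enorm v] into one time bound tau, with a common radius for
    invariance and descent. *)
Lemma local_direction X f x0 : comp_regular X -> C2 f -> X x0 ->
  ~ critical_point f X x0 ->
  exists v (rho tau : R), [/\ 0 < rho, 0 < tau,
    forall x s, X x -> enorm (x - x0) < rho -> 0 <= s <= tau -> X (x + s *: v) &
    forall x s t, enorm (x - x0) < rho -> 0 <= s -> s < t -> t <= tau ->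
      f (x + t *: v) < f (x + s *: v)].
Proof.
move=> crX C2f Xx0 ncrit.
have [v [gv [rho1 r1 inv]]] := comp_regular_direction X f x0 crX C2f Xx0 ncrit.
have [rho2 r2 desc] := descent_direction f x0 v C2f.1 (C2_continuous_gradient f C2f) gv.
pose rho := Num.min rho1 rho2.
have rho0 : 0 < rho by rewrite lt_min r1.
have rho1E : rho <= rho1 by rewrite ge_min lexx.
have rho2E : rho <= rho2 by rewrite ge_min lexx orbT.
have v0 := enorm_ge0 v.
have small (s : R) : 0 <= s -> s <= rho / (enorm v + 1) / 2 -> s * enorm v < rho.
  move=> s0; rewrite ler_pdivlMr// ler_pdivlMr; last by lra.
  nra.
exists v, rho, (rho / (enorm v + 1) / 2); split=> //.
- by rewrite !divr_gt0//; lra.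
- move=> x s Xx xx0 /andP[s0 st]; apply: inv => //; first lra.
  by have := small s s0 st; lra.
- move=> x s t xx0 s0 st tt; apply: desc => //; first lra.
  have := small t (le_trans s0 (ltW st)) tt; lra.
Qed.

(** The last clause is stronger than monotonicity: a trajectory moves only by losing height, so a
    level determines at most one of its points. *)
Definition descending_homotopy X f F : Prop :=
  [/\ continuous (fun p : R * 'rV[R]_d => F p.1 p.2),
      forall x, F 0 x = x,
      forall s x, 0 <= s <= 1 -> X x -> X (F s x) &
      forall s t x, X x -> 0 <= s -> s <= t -> t <= 1 ->
        F t x = F s x \/ f (F t x) < f (F s x)].

Lemma descending_le X f F s x : descending_homotopy X f F -> X x -> 0 <= s <= 1 ->
  f (F s x) <= f x.
Proof.
move=> [_ F0 _ Fd] Xx /andP[s0 s1].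
by have [->|/ltW] := Fd 0 s x Xx (lexx _) s0 s1; rewrite F0.
Qed.

Lemma descending_id X f : descending_homotopy X f (fun=> id).
Proof. by split=> // [p|s t x _ _ _ _]; [exact: cvg_snd|left]. Qed.

(** F runs on the first half, G on the second. Clamping both clocks gives continuity without gluing
    at s = 1/2. *)
Definition homotopy_concat F G : R -> 'rV[R]_d -> 'rV[R]_d :=
  fun s x => G (Num.max 0 (2 * s - 1)) (F (Num.min 1 (2 * s)) x).

Lemma homotopy_concat1 F G x : homotopy_concat F G 1 x = G 1 (F 1 x).
Proof.
have h : 2 - 1 = 1 :> R by lra.
by rewrite /homotopy_concat mulr1 h max_r ?ler01// min_l//; lra.
Qed.

Lemma descending_concat X f F G : descending_homotopy X f F ->
  descending_homotopy X f G -> descending_homotopy X f (homotopy_concat F G).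
Proof.
move=> [cF F0 FX Fd] [cG G0 GX Gd].
have minP (s : R) : 0 <= s <= 1 -> 0 <= Num.min 1 (2 * s) <= 1.
  by move=> /andP[s0 s1]; rewrite le_min ler01 ge_min lexx/= mulr_ge0.
have maxP (s : R) : 0 <= s <= 1 -> 0 <= Num.max 0 (2 * s - 1) <= 1.
  by move=> /andP[s0 s1]; rewrite le_max lexx/= ge_max ler01/=; lra.
split.
- have c1 : continuous (fun p : R * 'rV[R]_d => 2 * p.1).
    by move=> p; apply: cvgM; [exact: cvg_cst|exact: cvg_fst].
  have cmin : continuous (fun p : R * 'rV[R]_d => Num.min 1 (2 * p.1)).
    by apply: continuous_minr => // p; exact: cvg_cst.
  have cmax : continuous (fun p : R * 'rV[R]_d => Num.max 0 (2 * p.1 - 1)).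
    apply: continuous_maxr => p; first exact: cvg_cst.
    by apply: cvgB; [exact: c1|exact: cvg_cst].
  have cF' : continuous (fun p : R * 'rV[R]_d => F (Num.min 1 (2 * p.1)) p.2).
    by apply: continuous_compose (continuous_pair _ _ cmin _) cF => p; exact: cvg_snd.
  exact: continuous_compose (continuous_pair _ _ cmax cF') cG.
- by move=> x; rewrite /homotopy_concat mulr0 min_r// max_l ?G0 ?F0//; lra.
- by move=> s x s01 Xx; apply: GX; [exact: maxP|apply: FX => //; exact: minP].
move=> s t x Xx s0 st t1.
have Xt : X (F (Num.min 1 (2 * t)) x) by apply: FX => //; apply: minP; lra.
(* In the first half G has not started at time s, and the comparison passes through the F-point at
   time t; in the second, F is complete at both times. *)
rewrite /homotopy_concat; have [s2|s2] := leP s (1 / 2).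
  rewrite [Num.max 0 (2 * s - 1)]max_l ?G0; last by lra.
  have Gt : G (Num.max 0 (2 * t - 1)) (F (Num.min 1 (2 * t)) x) = F (Num.min 1 (2 * t)) x \/
      f (G (Num.max 0 (2 * t - 1)) (F (Num.min 1 (2 * t)) x)) < f (F (Num.min 1 (2 * t)) x).
    have /andP[m0 m1] : 0 <= Num.max 0 (2 * t - 1) <= 1 by apply: maxP; lra.
    by have := Gd 0 _ _ Xt (lexx _) m0 m1; rewrite G0.
  have Ft : F (Num.min 1 (2 * t)) x = F (Num.min 1 (2 * s)) x \/
      f (F (Num.min 1 (2 * t)) x) < f (F (Num.min 1 (2 * s)) x).
    apply: Fd => //.
    + by have /andP[] : 0 <= Num.min 1 (2 * s) <= 1 by apply: minP; lra.
    + by rewrite le_min !ge_min lexx/=; apply/orP; right; lra.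
    + by rewrite ge_min lexx.
  case: Gt => [->//|Gt]; right.
  by case: Ft => [<-//|]; exact: lt_trans.
have e1 : Num.min 1 (2 * s) = 1 by apply/min_idPl; lra.
have e2 : Num.min 1 (2 * t) = 1 by apply/min_idPl; lra.
rewrite e1; rewrite e2 in Xt *; apply: Gd => //.
- by rewrite le_max lexx.
- by rewrite ge_max !le_max lexx/=; apply/orP; right; lra.
- by rewrite ge_max ler01/=; lra.
Qed.

(** Each x travels along v for a time phi x, a tent function bounded by tau and positive exactly on
    the ball of radius rho; elsewhere nothing moves. *)
Lemma local_homotopy X f x0 : comp_regular X -> C2 f -> X x0 ->
  ~ critical_point f X x0 ->
  exists F (rho : R), [/\ descending_homotopy X f F, 0 < rho &
    forall x, X x -> enorm (x - x0) < rho -> f (F 1 x) < f x].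
Proof.
move=> crX C2f Xx0 ncrit.
have [v [rho [tau [rho0 tau0 inv desc]]]] := local_direction X f x0 crX C2f Xx0 ncrit.
pose phi x := tau * Num.max 0 (1 - enorm (x - x0) / rho).
have phiP x : (phi x = 0) \/ (enorm (x - x0) < rho /\ 0 < phi x <= tau).
  have [far|near] := leP rho (enorm (x - x0)).
    by left; rewrite /phi max_l ?mulr0// subr_le0 ler_pdivlMr// mul1r.
  right; split=> //; have h0 : 0 < 1 - enorm (x - x0) / rho.
    by rewrite subr_gt0 ltr_pdivrMr// mul1r.
  rewrite /phi max_r ?(ltW h0)// mulr_gt0//=.
  by rewrite ler_piMr ?(ltW tau0)// gerBl divr_ge0 ?enorm_ge0// ltW.
exists (fun s x => x + (s * phi x) *: v), rho; split=> //; first split.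
- have cbump : continuous (fun x => Num.max 0 (1 - enorm (x - x0) / rho)).
    apply: continuous_maxr => x; first exact: cst_continuous.
    apply: (@lip_continuous _ _ _ rho^-1) => y z.
    have h := ler_enorm_dist y z x0; rewrite (enormBC y z).
    have : (enorm (z - x0) - enorm (y - x0)) * rho^-1 <= enorm (z - y) * rho^-1.
      by rewrite ler_pM2r ?invr_gt0//; lra.
    lra.
  have cphi : continuous phi := continuous_compose _ _ cbump (@mulrl_continuous _ tau).
  move=> p; apply: cvgD; first exact: cvg_snd.
  apply: cvgZr_tmp; apply: cvgM; first exact: cvg_fst.
  by apply: continuous_compose cphi p => p; exact: cvg_snd.
- by move=> x; rewrite mul0r scale0r addr0.
- move=> s x /andP[s0 s1] Xx; case: (phiP x) => [->|[xx0 /andP[p0 pt]]].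
    by rewrite mulr0 scale0r addr0.
  by apply: inv => //; nra.
- move=> s t x Xx s0 st t1; case: (phiP x) => [->|[xx0 /andP[p0 pt]]].
    by left; rewrite !mulr0 !scale0r.
  move: st; rewrite le_eqVlt => /orP[/eqP->|st]; first by left.
  by right; apply: desc => //; nra.
move=> x Xx xx0; case: (phiP x) => [|[_ /andP[p0 pt]]].
  move=> /eqP; rewrite mulf_eq0 gt_eqF//= => /eqP h.
  have : 0 < 1 - enorm (x - x0) / rho by rewrite subr_gt0 ltr_pdivrMr// mul1r.
  by move=> h0; move: h; rewrite max_r ?(ltW h0)// => h; rewrite h ltxx in h0.
by have := desc x 0 (phi x) xx0 (lexx _) p0 pt; rewrite scale0r addr0 mul1r.
Qed.

End Homotopy.

(** * From local descent to the deformation retraction *)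

Section Retraction.
Context {R : realType} {d : nat}.
Implicit Types (K X : set 'rV[R]_d) (x : 'rV[R]_d).
Implicit Types (f : 'rV[R]_d -> R) (F G : R -> 'rV[R]_d -> 'rV[R]_d).

Lemma homotopy_compact X f K : compact K -> K `<=` X ->
  (forall x0, K x0 -> exists F (rho : R), [/\ descending_homotopy X f F, 0 < rho &
     forall x, X x -> enorm (x - x0) < rho -> f (F 1 x) < f x]) ->
  exists2 F, descending_homotopy X f F & forall x, K x -> f (F 1 x) < f x.
Proof.
move=> cK KX loc.
(* A dummy value off K makes the family total, as [choice] requires. *)
have {}loc x0 : exists p : (R -> 'rV[R]_d -> 'rV[R]_d) * R, K x0 ->
    [/\ descending_homotopy X f p.1, 0 < p.2 &
     forall x, X x -> enorm (x - x0) < p.2 -> f (p.1 1 x) < f x].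
  have [Kx0|nKx0] := pselect (K x0); last by exists (fun=> id, 0).
  by have [F [rho FP]] := loc x0 Kx0; exists (F, rho).
have [P PP] := choice loc.
have fin (s : seq 'rV[R]_d) : (forall x0, x0 \in s -> K x0) ->
    exists2 F, descending_homotopy X f F &
    forall x x0, X x -> x0 \in s -> enorm (x - x0) < (P x0).2 -> f (F 1 x) < f x.
  elim: s => [|x1 s IHs] sK; first by exists (fun=> id) => //; exact: descending_id.
  have [|F hF FP] := IHs; first by move=> x0 xs; apply: sK; rewrite inE xs orbT.
  have [hG rho0 GP] := PP x1 (sK x1 (mem_head _ _)).
  exists (homotopy_concat F (P x1).1) => [|x x0 Xx].
    exact: descending_concat.
  have [_ F0 FX Fd] := hF.
  have XF : X (F 1 x) by apply: FX => //; rewrite ler01 lexx.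
  (* Either the earlier homotopies fix x, and the one at x1 still acts on x itself, or they have
     already lowered f. *)
  have fF : F 1 x = x \/ f (F 1 x) < f x.
    by have := Fd 0 1 x Xx (lexx _) ler01 (lexx _); rewrite F0.
  have fG : f ((P x1).1 1 (F 1 x)) <= f (F 1 x).
    by apply: descending_le hG XF _; rewrite ler01 lexx.
  rewrite homotopy_concat1 inE => /orP[/eqP-> xx1|xs xx0].
    case: fF => [Fx|Fx]; last exact: le_lt_trans fG Fx.
    by rewrite Fx; exact: GP.
  by apply: le_lt_trans fG _; exact: FP xs xx0.
have : cover_compact K by rewrite -compact_cover.
move=> /(_ _ K (fun x0 => [set x | enorm (x - x0) < (P x0).2])) [].
- move=> x0 Kx0; rewrite (_ : [set x | _] = (fun x => enorm (x - x0)) @^-1` [set t | t < (P x0).2])//.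
  by apply: open_comp (@open_lt _ _) => y _; exact: enormB_continuous.
- by move=> x Kx; exists x => //=; have [_ r0 _] := PP x Kx; rewrite subrr enorm0.
move=> D DK KD; have [|F hF FP] := fin (finmap.enum_fset D).
  by move=> x0 xD; apply/set_mem; exact: DK.
exists F => // x Kx; have [x0 /= xD xx0] := KD x Kx.
exact: FP (KX _ Kx) xD xx0.
Qed.

Lemma homotopy_uniform X f K F : compact K -> continuous f ->
  descending_homotopy X f F -> (forall x, K x -> f (F 1 x) < f x) ->
  exists2 c : R, 0 < c & forall x, K x -> f (F 1 x) <= f x - c.
Proof.
move=> cK cf [cF _ _ _] FK.
have [K0|/set0P nK] := eqVneq K set0; first by exists 1 => // x; rewrite K0.
have c1 : continuous (fun x : 'rV[R]_d => (1 : R, x)).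
  by apply: continuous_pair => x; [exact: cst_continuous|exact: cvg_id].
have cF1 : continuous (F 1) := continuous_compose _ _ c1 cF.
have cg : continuous (fun x => f x - f (F 1 x)).
  have cfF := continuous_compose _ _ cF1 cf.
  by move=> x; apply: (@continuousB _ _ _ f (f \o F 1)); [exact: cf|exact: cfF].
have [x Kx xmin] := compact_min _ _ nK cK cg.
exists (f x - f (F 1 x)) => [|y Ky]; first by rewrite subr_gt0 FK.
by have := xmin y Ky; lra.
Qed.

(** As f never increases, a point still above a remains in the slab and loses another c, and a point
    below a stays there. *)
Lemma homotopy_iterate X f F (a b c : R) (n : nat) : descending_homotopy X f F ->
  (forall x, X x -> a <= f x <= b -> f (F 1 x) <= f x - c) -> 0 <= c ->
  exists2 G, descending_homotopy X f G &
    forall x, X x -> f x <= b -> f (G 1 x) <= Num.max a (f x - n%:R * c).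
Proof.
move=> hF Fc c0; elim: n => [|n [G hG Gn]].
  exists (fun=> id) => [|x Xx _]; first exact: descending_id.
  by rewrite mul0r subr0 le_max lexx orbT.
exists (homotopy_concat G F) => [|x Xx xb]; first exact: descending_concat.
have one : 0 <= (1 : R) <= 1 by rewrite ler01 lexx.
have XG : X (G 1 x) by case: hG => _ _ GX _; exact: GX.
have G1 := descending_le X f G 1 x hG Xx one.
have F1 := descending_le X f F 1 _ hF XG one.
have := Gn x Xx xb; rewrite homotopy_concat1 !le_max -natr1 mulrDl mul1r.
have [Ga _|/ltW Ga] := leP (f (G 1 x)) a; first by rewrite (le_trans F1).
have := Fc _ XG; rewrite Ga (le_trans G1 xb) => /(_ isT) h /orP[h1|h1]; apply/orP.
  by left; lra.
by right; lra.
Qed.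

(* Stopping each trajectory at level a. The stopping time need not be
   continuous, but the stopped point is the unique point of the trajectory at a
   prescribed level, so continuity follows from compactness of [0, 1]. *)
Lemma stopped_retract X f F (a b : R) : continuous f -> a <= b ->
  descending_homotopy X f F ->
  (forall x, X x -> f x <= b -> f (F 1 x) <= a) ->
  deformation_retract (sublevel X f a) (sublevel X f b).
Proof.
move=> cf ab hF Fa; have [cF F0 FX Fd] := hF.
split=> [x [Xx xa]|]; first by split=> //; exact: le_trans ab.
(* For f x <= a this is f x, so such points do not move; otherwise it follows the height of [F s x]
   down to a. *)
pose level s x : R := Num.min (f x) (Num.max a (f (F s x))).
have Finj x s t : X x -> 0 <= s <= 1 -> 0 <= t <= 1 -> f (F s x) = f (F t x) -> F s x = F t x.
  move=> Xx /andP[s0 s1] /andP[t0 t1] E.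
  have [st|/ltW ts] := leP s t.
    by have [->//|] := Fd s t x Xx s0 st t1; rewrite E ltxx.
  by have [->//|] := Fd t s x Xx t0 ts s1; rewrite E ltxx.
have cfF x : continuous (fun r => f (F r x)).
  have cx : continuous (fun r : R => (r, x)).
    by apply: continuous_pair => r; [exact: cvg_id|exact: cst_continuous].
  exact: continuous_compose _ _ (continuous_compose _ _ cx cF) cf.
(* Stopping times come from the intermediate value theorem; 0 is a dummy value where nothing is
   required. *)
have stop (p : R * 'rV[R]_d) : exists r, X p.2 -> 0 <= p.1 <= 1 ->
    0 <= r <= 1 /\ f (F r p.2) = level p.1 p.2.
  case: p => s x /=; have [Xx|nXx] := pselect (X x); last by exists 0.
  have [s01|ns] := boolP (0 <= s <= 1); last by exists 0.
  have fs := descending_le X f F s x hF Xx s01; case/andP: s01 => s0 s1.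
  have [||r] := @IVT _ (fun r => f (F r x)) 0 s (level s x) s0.
  - by apply: continuous_subspaceT; exact: cfF.
  - rewrite F0 (min_idPr fs) (max_idPl fs) /level ge_min lexx andbT.
    by rewrite le_min fs le_max lexx orbT.
  rewrite in_itv/= => /andP[r0 rs] rE.
  by exists r => _ _; split=> //; rewrite r0 (le_trans rs s1).
have [tau tauP] := choice stop.
pose H s x := F (tau (s, x)) x.
have HP s x : X x -> 0 <= s <= 1 ->
    0 <= tau (s, x) <= 1 /\ f (H s x) = level s x.
  by move=> Xx s01; exact: tauP (s, x) Xx s01.
have HE s x r : X x -> 0 <= s <= 1 -> 0 <= r <= 1 -> f (F r x) = level s x -> H s x = F r x.
  move=> Xx s01 r01 rE; have [t01 tE] := HP s x Xx s01.
  by apply: Finj => //; rewrite rE.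
have z01 : 0 <= (0 : R) <= 1 by rewrite lexx ler01.
exists H; split; [|split; [|split; [|split]]]; first last.
- move=> s x s01 [Xx xa]; rewrite (HE s x 0) ?F0//.
  by rewrite /level min_l// le_max xa.
- move=> x [Xx xb]; have [|t01 tE] := HP 1 x Xx; first by rewrite ler01 lexx.
  split; first exact: FX.
  by rewrite tE /level ge_min ge_max lexx Fa// orbT.
- move=> x [Xx xb]; rewrite (HE 0 x 0) ?F0//.
  by rewrite /level F0 min_l// le_max lexx orbT.
- move=> s x s01 [Xx xb]; have [t01 tE] := HP s x Xx s01.
  by split; [exact: FX|rewrite tE /level ge_min xb].
have clevel : continuous (fun p : R * 'rV[R]_d => level p.1 p.2).
  have cfst : continuous (fun p : R * 'rV[R]_d => f p.2).
    by apply: continuous_compose cf => p; exact: cvg_snd.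
  have cfFp : continuous (fun p : R * 'rV[R]_d => f (F p.1 p.2)).
    exact: continuous_compose cF cf.
  apply: continuous_minr => //; apply: continuous_maxr => // p.
  exact: cst_continuous.
set D := [set p : R * 'rV[R]_d | _].
apply/subspace_continuousP => -[s x] /= [s01 [Xx xb]].
apply: contrapT => ncv.
have [U Ux nU] : exists2 U, nbhs (H s x) U &
    ~ within D (nbhs (s, x)) [set p | U (H p.1 p.2)].
  apply: contrapT => nex; apply: ncv => U Ux; apply: contrapT => nU.
  by apply: nex; exists U.
(* N gathers the points near (s, x) that H sends outside U. Their stopping times cluster at some r;
   by continuity [F r x] has height [level s x], hence equals [H s x], and continuity of F at (r, x)
   is contradicted. *)
pose N := within (D `&` [set p | ~ U (H p.1 p.2)]) (nbhs (s, x)).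
have PN : ProperFilter N.
  apply: Build_ProperFilter_ex => Q NQ; apply: contrapT => nQ; apply: nU.
  have {}NQ : nbhs (s, x) [set p | (D `&` [set p | ~ U (H p.1 p.2)]) p -> Q p] := NQ.
  rewrite /within /=; apply: filterS NQ => p pQ Dp; apply: contrapT => np; apply: nQ.
  by exists p; apply: pQ.
have N01 : (tau @ N) `[0, 1]%classic.
  apply: (@filterE _ (nbhs (s, x))) => -[s' x'] [[s'01 [Xx' _]] _] /=.
  by rewrite in_itv/=; exact: (HP s' x' Xx' s'01).1.
have [r [/= r01 rcl]] := @segment_compact R 0 1 (tau @ N) _ N01.
rewrite in_itv/= in r01.
have clus (P Q : set (R * 'rV[R]_d)) : nbhs (r, x) P -> nbhs (s, x) Q ->
    exists p, [/\ D p, ~ U (H p.1 p.2), Q p & P (tau p, p.2)].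
  move=> [[W M] /= [rW xM] WM] sxQ.
  pose E := [set p | [/\ D p, ~ U (H p.1 p.2), Q p & M p.2]].
  have NE : (tau @ N) (tau @` E).
    have sxM : nbhs (s, x) [set p : R * 'rV[R]_d | M p.2] by exact: cvg_snd xM.
    apply: filterS (filterI sxQ sxM) => p [Qp Mp] [Dp nUp].
    by exists p.
  have [_ [[p [Dp nUp Qp Mp] <-] Wp]] := rcl _ _ NE rW.
  by exists p; split=> //; apply: WM.
have rE : f (F r x) = level s x.
  apply/eqP; rewrite -subr_eq0 -normr_eq0; apply/negPn/negP => ne.
  have {}ne : 0 < `|f (F r x) - level s x| by rewrite lt_def ne normr_ge0.
  set e := `|_| in ne.
  have e2 : 0 < e / 2 by rewrite divr_gt0.
  have cfF' : continuous (fun p : R * 'rV[R]_d => f (F p.1 p.2)).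
    exact: continuous_compose cF cf.
  have n1 := (cvgrPdist_lt _ _).1 (cfF' (r, x)) _ e2.
  have n2 := (cvgrPdist_lt _ _).1 (clevel (s, x)) _ e2.
  have [[s' x'] [[s'01 [Xx' _]] _ /= l2 /= l1]] := clus _ _ (n1 _) (n2 _).
  have [_ E] := HP s' x' Xx' s'01; rewrite -[F _ x']/(H s' x') E in l1.
  have := ler_normD (f (F r x) - level s' x') (level s' x' - level s x).
  by rewrite subrKA -/e (distrC (level s' x')); lra.
have HrE := HE s x r Xx s01 r01 rE; rewrite HrE in Ux.
have [[s' x'] [_ nUp _]] := clus _ _ (cF (r, x) _ Ux) (@filterT _ (nbhs (s, x)) _).
by [].
Qed.

End Retraction.

Theorem mainTheorem4 (R : realType) (d : nat) (X : set 'rV[R]_d)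
    (f : 'rV[R]_d -> R) (a b : R) :
  comp_regular X -> C2 f -> a < b ->
  (forall t, a <= t <= b -> regular_value f X t) ->
  deformation_retract (sublevel X f a) (sublevel X f b).
Proof.
move=> crX C2f ab reg; have cX := crX.1.
have cf : continuous f by move=> x; apply: differentiable_continuous; exact: C2f.1.
pose K := X `&` (f @^-1` `[a, b]%classic).
have cK : compact K.
  apply: compact_closedI => //; apply: closed_comp; last exact: interval_closed.
  by move=> x _; exact: cf.
have KX : K `<=` X by move=> x [].
have [|F hF FK] := homotopy_compact X f K cK KX.
  move=> x0 [Xx0 /=]; rewrite in_itv/= => fx0.
  by apply: local_homotopy => //; exact: (reg _ fx0).
have [c c0 Fc] := homotopy_uniform X f K F cK cf hF FK.
(* Enough iterations for drops of c to cover b - a. *)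
pose n := Num.bound ((b - a) / c).
have nc : b - a <= n%:R * c.
  rewrite -ler_pdivrMr//; apply/ltW/archi_boundP.
  by rewrite divr_ge0 ?(ltW c0)// subr_ge0 ltW.
have [|G hG Gn] := homotopy_iterate X f F a b c n hF _ (ltW c0).
  by move=> x Xx fx; apply: Fc; split=> //=; rewrite in_itv.
apply: stopped_retract cf (ltW ab) hG _ => x Xx xb.
by apply: le_trans (Gn x Xx xb) _; rewrite ge_max lexx/=; lra.
Qed.
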